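(* Let $p$ be a prime integer, let $A = \mathbb{Z}$ or $A = \mathbb{Z}_p$ (the $p$-adic integers), let $R = A[x_1,\dots,x_d]$ be a polynomial ring, let $\delta$ be a fixed $p$-derivation on $R$, and let $Q$ be a prime ideal of $R$ such that $Q \cap A = (p)$. Then $Q^{(n)} = Q^{\langle n\rangle_{\mathrm{mix}}}$ for all $n \geq 1$, where $Q^{\langle n\rangle_{\mathrm{mix}}}$ is the $n$-th mixed differential power of $Q$ with respect to $\delta$ and $A$.
   Context: All rings are commutative with identity. For a prime ideal $Q$ of a ring $R$ and $n\ge 1$, the $n$-th symbolic power of $Q$ is $Q^{(n)} = Q^nR_Q\cap R$ (the preimage of $Q^nR_Q$ under $R\to R_Q$). For a ring map $A\to R$, the sets of $A$-linear differential operators on $R$ of order at most $n$ are defined inductively: $D^0_{R|A}=\mathrm{Hom}_R(R,R)\subseteq \mathrm{Hom}_A(R,R)$ (multiplications by elements of $R$), and for $n\ge 1$, $D^n_{R|A}=\{\partial\in \mathrm{Hom}_A(R,R) \mid [\partial,f]=\partial\circ f-f\circ\partial\in D^{n-1}_{R|A} \text{ for all } f\in D^0_{R|A}\}$. For a prime integer $p$ and a ring $R$ on which $p$ is a nonzerodivisor, a $p$-derivation on $R$ is a set-theoretic map $\delta:R\to R$ such that $x\mapsto x^p+p\,\delta(x)$ is a ring homomorphism $R\to R$. Write $\delta^a$ for the $a$-fold self-composition of $\delta$, with $\delta^0=\mathrm{id}$. The $n$-th mixed differential power of an ideal $I$ of $R$ (with respect to $\delta$ and $A$) is $$I^{\langle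 n\rangle_{\mathrm{mix}}}=\{f\in R\mid (\delta^a\circ\partial)(f)\in I \text{ for all integers } a,b\ge 0 \text{ with } a+b\le n-1 \text{ and all } \partial\in D^b_{R|A}\}.$$ *)

(* Defs.v *)
(* MathComp, with classical logic and sets from mathcomp.classical. *)
From HB Require Import structures.
From mathcomp Require Import all_boot all_order all_algebra.
From mathcomp Require Import generic_quotient ring_quotient.
From mathcomp Require Import boolp classical_sets.
From mathcomp Require Import ring.

Set Implicit Arguments.
Unset Strict Implicit.
Unset Printing Implicit Defensive.

Import GRing.Theory.

Local Open Scope ring_scope.
Local Open Scope quotient_scope.
Local Open Scope classical_set_scope.

Section PadicIntegers.
Variable p : nat.

(* Exponents are shifted by one because ['Z_(p ^ 0)] is Z/2 and not the zero
   ring. *)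
Definition padic_red (n : nat) (x : 'Z_(p ^ n.+2)) : 'Z_(p ^ n.+1) := inZp x.

Lemma padic_modulus_dvd n :
  ((Zp_trunc (p ^ n.+1)).+2 %| (Zp_trunc (p ^ n.+2)).+2)%N.
Proof.
case: p => [|[|q]]; rewrite ?exp0n ?exp1n //.
by rewrite !Zp_cast ?dvdn_exp2l // -[1%N](expn0 q.+2) ltn_exp2l.
Qed.

Lemma padic_redD n : {morph @padic_red n : x y / x + y}.
Proof.
by move=> x y; apply: val_inj; rewrite /= modnDm modn_dvdm ?padic_modulus_dvd.
Qed.

Lemma padic_redM n : {morph @padic_red n : x y / x * y}.
Proof.
by move=> x y; apply: val_inj; rewrite /= modnMm modn_dvdm ?padic_modulus_dvd.
Qed.

Lemma padic_red0 n : @padic_red n 0 = 0.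
Proof. by apply: val_inj; rewrite /= mod0n. Qed.

Lemma padic_red1 n : @padic_red n 1 = 1.
Proof. by apply: val_inj. Qed.

Lemma padic_redN n : {morph @padic_red n : x / - x}.
Proof.
by move=> x; apply: (@addIr _ (padic_red x)); rewrite -padic_redD !addNr padic_red0.
Qed.

(* The inverse limit of the rings Z/p^n. *)
Record padic_int := PadicInt {
  padic_comp : forall n : nat, 'Z_(p ^ n.+1);
  padic_compat : forall n, padic_red (padic_comp n.+1) = padic_comp n
}.

HB.instance Definition _ := gen_eqMixin padic_int.
HB.instance Definition _ := gen_choiceMixin padic_int.

Lemma padic_int_ext (x y : padic_int) :
  (forall n, padic_comp x n = padic_comp y n) -> x = y.
Proof.
case: x y => [x hx] [y hy] /= e.
have exy : x = y by apply: functional_extensionality_dep.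
by subst y; congr PadicInt; apply: Prop_irrelevance.
Qed.

Definition padic_zero := @PadicInt (fun=> 0) padic_red0.
Definition padic_one := @PadicInt (fun=> 1) padic_red1.

Lemma padic_opp_compat (x : padic_int) n :
  padic_red (- padic_comp x n.+1) = - padic_comp x n.
Proof. by rewrite padic_redN padic_compat. Qed.
Definition padic_opp x := PadicInt (padic_opp_compat x).

Lemma padic_add_compat (x y : padic_int) n :
  padic_red (padic_comp x n.+1 + padic_comp y n.+1)
    = padic_comp x n + padic_comp y n.
Proof. by rewrite padic_redD !padic_compat. Qed.
Definition padic_add x y := PadicInt (padic_add_compat x y).

Lemma padic_mul_compat (x y : padic_int) n :
  padic_red (padic_comp x n.+1 * padic_comp y n.+1)
    = padic_comp x n * padic_comp y n.
Proof. by rewrite padic_redM !padic_compat. Qed.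
Definition padic_mul x y := PadicInt (padic_mul_compat x y).

Lemma padic_addA : associative padic_add.
Proof. by move=> x y z; apply: padic_int_ext => n; apply: addrA. Qed.
Lemma padic_addC : commutative padic_add.
Proof. by move=> x y; apply: padic_int_ext => n; apply: addrC. Qed.
Lemma padic_add0 : left_id padic_zero padic_add.
Proof. by move=> x; apply: padic_int_ext => n; apply: add0r. Qed.
Lemma padic_addN : left_inverse padic_zero padic_opp padic_add.
Proof. by move=> x; apply: padic_int_ext => n; apply: addNr. Qed.

HB.instance Definition _ :=
  GRing.isZmodule.Build padic_int padic_addA padic_addC padic_add0 padic_addN.

Lemma padic_mulA : associative padic_mul.
Proof. by move=> x y z; apply: padic_int_ext => n; apply: mulrA. Qed.
Lemma padic_mulC : commutative padic_mul.
Proof. by move=> x y; apply: padic_int_ext => n; apply: mulrC. Qed.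
Lemma padic_mul1 : left_id padic_one padic_mul.
Proof. by move=> x; apply: padic_int_ext => n; apply: mul1r. Qed.
Lemma padic_mulDl : left_distributive padic_mul padic_add.
Proof. by move=> x y z; apply: padic_int_ext => n; apply: mulrDl. Qed.
Lemma padic_one_neq0 : padic_one != padic_zero.
Proof. by apply/eqP => /(congr1 (fun x => padic_comp x 0)). Qed.

HB.instance Definition _ :=
  GRing.Zmodule_isComNzRing.Build padic_int
    padic_mulA padic_mulC padic_mul1 padic_mulDl padic_one_neq0.

End PadicIntegers.

Section Localization.
Variables (R : comNzRingType) (Q : prime_idealr R).

Record loc_pair := LocPair {
  loc_num : R;
  loc_den : R;
  loc_denP : loc_den \notin Q
}.

HB.instance Definition _ := gen_eqMixin loc_pair.
HB.instance Definition _ := gen_choiceMixin loc_pair.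

Definition loc_rel (x y : loc_pair) : bool :=
  `[< exists2 u : R, u \notin Q &
        u * (loc_num x * loc_den y - loc_num y * loc_den x) = 0 >].

Lemma loc_notin1 : 1 \notin Q.
Proof. by rewrite idealr1. Qed.

Lemma loc_notinM (s t : R) : s \notin Q -> t \notin Q -> s * t \notin Q.
Proof. by move=> hs ht; rewrite prime_idealrM negb_or hs. Qed.

Lemma loc_rel_refl : reflexive loc_rel.
Proof.
by move=> x; apply/asboolP; exists 1; rewrite ?loc_notin1 // subrr mulr0.
Qed.

Lemma loc_rel_sym : symmetric loc_rel.
Proof.
move=> x y; apply/asboolP/asboolP => -[u hu e]; exists u => //.
all: by rewrite -opprB mulrN e oppr0.
Qed.

Lemma loc_rel_trans : transitive loc_rel.
Proof.
move=> y x z /asboolP[u hu e] /asboolP[v hv f]; apply/asboolP.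
exists (u * v * loc_den y); first by rewrite !loc_notinM // loc_denP.
transitivity (v * loc_den z * (u * (loc_num x * loc_den y - loc_num y * loc_den x))
  + u * loc_den x * (v * (loc_num y * loc_den z - loc_num z * loc_den y))).
  by ring.
by rewrite e f !mulr0 addr0.
Qed.

Canonical loc_equiv := EquivRel loc_rel loc_rel_refl loc_rel_sym loc_rel_trans.

Definition localization := {eq_quot loc_equiv}.

HB.instance Definition _ : EqQuotient _ loc_equiv localization :=
  EqQuotient.on localization.
HB.instance Definition _ := Choice.on localization.


Local Notation loc := localization.

Lemma loc_pi_eq (x y : loc_pair) (u : R) : u \notin Q ->
  u * (loc_num x * loc_den y - loc_num y * loc_den x) = 0 ->
  \pi_loc x = \pi_loc y.
Proof. by move=> hu e; apply/eqmodP/asboolP; exists u. Qed.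

Lemma loc_pi_repr (x : loc_pair) : exists2 u : R, u \notin Q &
  u * (loc_num (repr (\pi_loc x)) * loc_den x
       - loc_num x * loc_den (repr (\pi_loc x))) = 0.
Proof. by apply/asboolP; apply/(eqmodP loc_equiv); rewrite reprK. Qed.

Definition loc_frac_pair (a : R) : loc_pair := LocPair a loc_notin1.
Definition loc_opp_pair (x : loc_pair) : loc_pair :=
  LocPair (- loc_num x) (loc_denP x).
Definition loc_add_pair (x y : loc_pair) : loc_pair :=
  @LocPair (loc_num x * loc_den y + loc_num y * loc_den x)
           (loc_den x * loc_den y) (loc_notinM (loc_denP x) (loc_denP y)).
Definition loc_mul_pair (x y : loc_pair) : loc_pair :=
  @LocPair (loc_num x * loc_num y)
           (loc_den x * loc_den y) (loc_notinM (loc_denP x) (loc_denP y)).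

Definition loc_map (a : R) : localization := \pi_loc (loc_frac_pair a).
Definition loc_opp (a : localization) : localization :=
  \pi_loc (loc_opp_pair (repr a)).
Definition loc_add (a b : localization) : localization :=
  \pi_loc (loc_add_pair (repr a) (repr b)).
Definition loc_mul (a b : localization) : localization :=
  \pi_loc (loc_mul_pair (repr a) (repr b)).

Lemma loc_oppE x : loc_opp (\pi_loc x) = \pi_loc (loc_opp_pair x).
Proof.
have [u hu e] := loc_pi_repr x; apply: (loc_pi_eq hu) => /=.
by rewrite !mulNr -opprD mulrN e oppr0.
Qed.

Lemma loc_addE x y :
  loc_add (\pi_loc x) (\pi_loc y) = \pi_loc (loc_add_pair x y).
Proof.
have [u hu e] := loc_pi_repr x; have [v hv f] := loc_pi_repr y.
apply: (loc_pi_eq (loc_notinM hu hv)) => /=.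
move: e f; set x' := repr (\pi_loc x); set y' := repr (\pi_loc y) => e f.
transitivity
  (v * loc_den y * loc_den y' *
     (u * (loc_num x' * loc_den x - loc_num x * loc_den x'))
   + u * loc_den x * loc_den x' *
     (v * (loc_num y' * loc_den y - loc_num y * loc_den y'))).
  by ring.
by rewrite e f !mulr0 addr0.
Qed.

Lemma loc_mulE x y :
  loc_mul (\pi_loc x) (\pi_loc y) = \pi_loc (loc_mul_pair x y).
Proof.
have [u hu e] := loc_pi_repr x; have [v hv f] := loc_pi_repr y.
apply: (loc_pi_eq (loc_notinM hu hv)) => /=.
move: e f; set x' := repr (\pi_loc x); set y' := repr (\pi_loc y) => e f.
transitivity
  (v * loc_num y' * loc_den y *
     (u * (loc_num x' * loc_den x - loc_num x * loc_den x'))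
   + u * loc_num x * loc_den x' *
     (v * (loc_num y' * loc_den y - loc_num y * loc_den y'))).
  by ring.
by rewrite e f !mulr0 addr0.
Qed.

Lemma loc_addA : associative loc_add.
Proof.
elim/quotW=> x; elim/quotW=> y; elim/quotW=> z.
rewrite (loc_addE y z) (loc_addE x y) !loc_addE.
by apply: (loc_pi_eq loc_notin1) => /=; ring.
Qed.

Lemma loc_addC : commutative loc_add.
Proof.
elim/quotW=> x; elim/quotW=> y; rewrite !loc_addE.
by apply: (loc_pi_eq loc_notin1) => /=; ring.
Qed.

Lemma loc_add0 : left_id (loc_map 0) loc_add.
Proof.
elim/quotW=> x; rewrite !loc_addE.
by apply: (loc_pi_eq loc_notin1) => /=; ring.
Qed.

Lemma loc_addN : left_inverse (loc_map 0) loc_opp loc_add.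
Proof.
elim/quotW=> x; rewrite loc_oppE !loc_addE.
by apply: (loc_pi_eq loc_notin1) => /=; ring.
Qed.

HB.instance Definition _ :=
  GRing.isZmodule.Build localization loc_addA loc_addC loc_add0 loc_addN.

Lemma loc_mulA : associative loc_mul.
Proof.
elim/quotW=> x; elim/quotW=> y; elim/quotW=> z.
rewrite (loc_mulE y z) (loc_mulE x y) !loc_mulE.
by apply: (loc_pi_eq loc_notin1) => /=; ring.
Qed.

Lemma loc_mulC : commutative loc_mul.
Proof.
elim/quotW=> x; elim/quotW=> y; rewrite !loc_mulE.
by apply: (loc_pi_eq loc_notin1) => /=; ring.
Qed.

Lemma loc_mul1 : left_id (loc_map 1) loc_mul.
Proof.
elim/quotW=> x; rewrite !loc_mulE.
by apply: (loc_pi_eq loc_notin1) => /=; ring.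
Qed.

Lemma loc_mulDl : left_distributive loc_mul loc_add.
Proof.
elim/quotW=> x; elim/quotW=> y; elim/quotW=> z.
rewrite (loc_addE x y) (loc_mulE x z) (loc_mulE y z) loc_mulE loc_addE.
by apply: (loc_pi_eq loc_notin1) => /=; ring.
Qed.

Lemma loc_one_neq0 : loc_map 1 != loc_map 0.
Proof.
apply/eqP => /eqmodP/asboolP[u hu] /=.
by rewrite !mulr1 subr0 mulr1 => u0; rewrite u0 idealr0 in hu.
Qed.

HB.instance Definition _ :=
  GRing.Zmodule_isComNzRing.Build localization
    loc_mulA loc_mulC loc_mul1 loc_mulDl loc_one_neq0.

Lemma loc_map_zmod_morphism : zmod_morphism loc_map.
Proof.
move=> a b; rewrite -[RHS]/(loc_add (loc_map a) (loc_opp (loc_map b))).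
rewrite loc_oppE loc_addE.
by apply: (loc_pi_eq loc_notin1) => /=; ring.
Qed.

Lemma loc_map_monoid_morphism : monoid_morphism loc_map.
Proof.
split=> // a b; rewrite -[RHS]/(loc_mul (loc_map a) (loc_map b)) loc_mulE.
by apply: (loc_pi_eq loc_notin1) => /=; ring.
Qed.

HB.instance Definition _ :=
  GRing.isZmodMorphism.Build R localization loc_map loc_map_zmod_morphism.
HB.instance Definition _ :=
  GRing.isMonoidMorphism.Build R localization loc_map loc_map_monoid_morphism.

End Localization.

Arguments loc_map {R} Q a.

Section IdealPowers.
Variable R : comNzRingType.

Definition ideal_span (S : set R) : set R :=
  [set f | exists (m : nat) (a s : 'I_m -> R),
     (forall i, S (s i)) /\ f = \sum_(i < m) a i * s i].

Definition ideal_mul (I J : set R) : set R :=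
  ideal_span [set f | exists2 x, I x & exists2 y, J y & f = x * y].

Definition ideal_exp (I : set R) (n : nat) : set R :=
  iter n (ideal_mul I) setT.

End IdealPowers.

Definition symbolic_power (R : comNzRingType) (Q : prime_idealr R) (n : nat) :
    set R :=
  loc_map Q @^-1` ideal_span (loc_map Q @` ideal_exp [set` Q] n).

(* Only meaningful when p is prime and not a zero divisor in R. *)
Definition is_p_derivation (R : comNzRingType) (p : nat) (delta : R -> R) :
    Prop :=
  let phi := fun x => x ^+ p + p%:R * delta x in
  zmod_morphism phi /\ monoid_morphism phi.

Section DifferentialPowers.
Variables (A : comNzRingType) (R : comAlgType A).

Definition is_multiplication (g : R -> R) : Prop :=
  exists r : R, g = *%R r.

Fixpoint diffop (n : nat) (D : R -> R) : Prop :=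
  if n is m.+1 then
    linear D /\
    (forall g, is_multiplication g -> diffop m (fun x => D (g x) - g (D x)))
  else is_multiplication D.

Definition mixed_power (delta : R -> R) (I : set R) (n : nat) : set R :=
  [set f | forall (a b : nat) (D : R -> R),
     (a + b < n)%N -> diffop b D -> I (iter a delta (D f))].

End DifferentialPowers.

Arguments mixed_power A {R} delta I n.

(* Main.v *)
Require Import Defs.
From HB Require Import structures.
From mathcomp Require Import all_boot all_order all_algebra.
From mathcomp Require Import generic_quotient ring_quotient.
From mathcomp Require Import boolp classical_sets.
From mathcomp Require Import mpoly.
From mathcomp Require Import ring zify.

Set Implicit Arguments.
Unset Strict Implicit.
Unset Printing Implicit Defensive.

Import GRing.Theory.

Local Open Scope ring_scope.
Local Open Scope classical_set_scope.

(** Write R = A[x_1..x_d], R_S = A[x_i : i in S] and B_S = Q /\ R_S. Only four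
facts about A and Q matter: p is not a zero divisor in A, c^p = c modulo p
for every c in A, the constants in Q are the multiples of p, and p is in Q.

Symbolic powers are contained in mixed powers because an operator of order b
lowers the symbolic order by at most b ([diffop_symbolic]) and delta lowers it
by at most 1 ([p_derivation_symbolic]). The second fact needs p in Q: the lift
of Frobenius phi(x) = x^p + p delta(x) then satisfies phi(x) in Q iff x in Q.

Below Q^(k) is the symbolic power and Q^k the ordinary one. For the converse,
induction on n reduces, up to a multiplier outside Q, to an f that lies in Q^n
and in the mixed power of exponent n+1, and f must be shown to lie in Q^(n+1).
The proof ([mixed_contraction]) descends on the set S of variables, for f in
<B_S>^n + Q^(n+1), starting from the set of all variables, where B_S is Q.
There are two cases for S.

- All derivatives of elements of B_S along the variables of S lie in Q. Then
  every element of B_S is a multiple of p ([contraction_pdiv]): modulo p an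
  element of minimal degree would have zero derivatives, hence would be the
  p-th power of an element of smaller degree which is again in Q. So f is
  p^n u modulo Q^(n+1), and delta^n (p^n u + v) is in Q only if u is
  ([iter_p_derivation_detect]), because delta removes exactly one factor p.

- Some g in B_S has its derivative along x_i outside Q. Then a relation m of
  minimal degree in x_i over R_(S-i) generates B_S together with B_(S-i)
  up to multipliers outside Q (by pseudo-division), and dm/dx_i is not in Q
  ([separable_generator]). Hence, up to such a multiplier and modulo Q^(n+1),
  f is a sum of m^j e_j with e_j in <B_(S-i)>^{n-j}. The Hasse derivative D of order b
  along x_i is linear over R_(S-i), so if b is the largest j that occurs, then
  D f is (dm/dx_i)^b e_b modulo Q^(n-b+1). As D f is in the mixed power of
  exponent n-b+1, the induction hypothesis for S - i puts e_b into
  Q^(n-b+1), so that m^b e_b can be discarded ([mixed_expansion]). No division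
  by b! occurs, since Hasse derivatives are used.

Choosing the variables greedily in this way replaces the theory of separating
transcendence bases and of regular local rings. *)

(** * Powers of ideals *)

Section IdealPowers.
Variable R : comNzRingType.
Implicit Types (B C : set R) (f g : R).

Lemma ideal_span0 B : ideal_span B 0.
Proof.
by exists 0%N, (fun=> 0), (fun=> 0); split=> [[]|]//; rewrite big_ord0.
Qed.

Lemma ideal_span_mul B a f : B f -> ideal_span B (a * f).
Proof.
move=> Bf; exists 1%N, (fun=> a), (fun=> f); split=> //.
by rewrite big_ord1.
Qed.

Lemma ideal_span_add B f g :
  ideal_span B f -> ideal_span B g -> ideal_span B (f + g).
Proof.
move=> [m [a [s [Bs ->]]]] [k [b [t [Bt ->]]]].
exists (m + k)%N, (fun i => match split i with inl j => a j | inr j => b j end),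
  (fun i => match split i with inl j => s j | inr j => t j end); split.
  by move=> i; case: (split i).
rewrite big_split_ord /=; congr (_ + _); apply: eq_bigr => i _.
  by rewrite -[lshift k i]/(unsplit (inl i)) unsplitK.
by rewrite -[rshift m i]/(unsplit (inr i)) unsplitK.
Qed.

Lemma ideal_span_ind B (K : R -> Prop) :
    K 0 -> (forall f g, K f -> K g -> K (f + g)) ->
    (forall a f, B f -> K (a * f)) ->
  forall f, ideal_span B f -> K f.
Proof.
move=> K0 KD KM f [m [a [s [Bs ->]]]].
by elim/big_ind: _ => // i _; apply: KM.
Qed.

Lemma ideal_span_scale B a f : ideal_span B f -> ideal_span B (a * f).
Proof.
elim/ideal_span_ind => [|g h Kg Kh|b g Bg].
- by rewrite mulr0; apply: ideal_span0.
- by rewrite mulrDr; apply: ideal_span_add.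
- by rewrite mulrA; apply: ideal_span_mul.
Qed.

Lemma ideal_exp0 B n : ideal_exp B n 0.
Proof. by case: n => // n; apply: ideal_span0. Qed.

Lemma ideal_exp_add B n f g :
  ideal_exp B n f -> ideal_exp B n g -> ideal_exp B n (f + g).
Proof. by case: n => // n; apply: ideal_span_add. Qed.

Lemma ideal_exp_scale B n a f : ideal_exp B n f -> ideal_exp B n (a * f).
Proof. by case: n => // n; apply: ideal_span_scale. Qed.

Lemma ideal_exp_opp B n f : ideal_exp B n f -> ideal_exp B n (- f).
Proof. by rewrite -mulN1r; apply: ideal_exp_scale. Qed.

Lemma ideal_exp_mul B n x f :
  B x -> ideal_exp B n f -> ideal_exp B n.+1 (x * f).
Proof.
move=> Bx Ef; rewrite -[x * f]mul1r; apply: ideal_span_mul.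
by exists x => //; exists f.
Qed.

(** The coefficient of a generator x * f is absorbed in f, so that an additive
property need only be checked on the products themselves. *)
Lemma ideal_exp_ind B n (K : R -> Prop) :
    K 0 -> (forall f g, K f -> K g -> K (f + g)) ->
    (forall x f, B x -> ideal_exp B n f -> K (x * f)) ->
  forall f, ideal_exp B n.+1 f -> K f.
Proof.
move=> K0 KD KM f; elim/ideal_span_ind => // a _ [x Bx [g Eg ->]].
by rewrite mulrCA; apply: KM => //; apply: ideal_exp_scale.
Qed.

Lemma ideal_exp_sub B C n f :
  B `<=` C -> ideal_exp B n f -> ideal_exp C n f.
Proof.
move=> BC; elim: n f => // n IH f; elim/ideal_exp_ind.
- exact: ideal_exp0.
- by move=> g h; apply: ideal_exp_add.
- by move=> x g Bx /IH; apply: ideal_exp_mul; apply: BC.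
Qed.

Lemma ideal_exp_le B m n f : (m <= n)%N -> ideal_exp B n f -> ideal_exp B m f.
Proof.
move=> /subnK <-; elim: (n - m)%N f => // k IH f; rewrite addSn => Ef.
apply: IH; move: f Ef; apply: ideal_exp_ind.
- exact: ideal_exp0.
- by move=> g h; apply: ideal_exp_add.
- by move=> x g _; apply: ideal_exp_scale.
Qed.

End IdealPowers.

(** * Symbolic powers *)

Section SymbolicPowers.
Local Open Scope quotient_scope.
Variables (R : comNzRingType) (Q : prime_idealr R).
Implicit Types (f g s : R).
Local Notation E := (ideal_exp [set` Q]).
Local Notation Sy := (symbolic_power Q).

Lemma prime_notinX s n : s \notin Q -> s ^+ n \notin Q.
Proof.
move=> sQ; elim: n => [|n IH]; first by rewrite expr0 loc_notin1.
by rewrite exprS loc_notinM.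
Qed.

Lemma prime_notin_mulr s f : s \notin Q -> s * f \in Q -> f \in Q.
Proof. by move=> sQ; rewrite prime_idealrM (negPf sQ). Qed.

(** The finitely many denominators that occur in an element of the extended
ideal are cleared one at a time. *)
Lemma loc_span_clear n (z : localization Q) :
    ideal_span (loc_map Q @` E n) z ->
  exists2 s, s \notin Q & exists2 e, E n e & loc_map Q s * z = loc_map Q e.
Proof.
elim/ideal_span_ind.
- exists 1; first exact: loc_notin1.
  by exists 0; [apply: ideal_exp0 | rewrite mulr0 rmorph0].
- move=> x y [s sQ [e Ee es]] [t tQ [h Eh ht]].
  exists (s * t); first exact: loc_notinM.
  exists (t * e + s * h).
    by apply: ideal_exp_add; apply: ideal_exp_scale.
  by rewrite rmorphM rmorphD !rmorphM /= -es -ht; ring.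
- elim/quotW=> a _ [e Ee <-]; exists (loc_den a); first exact: loc_denP.
  exists (loc_num a * e); first exact: ideal_exp_scale.
  rewrite rmorphM mulrA; congr (_ * _).
  rewrite -[LHS]/(loc_mul (loc_map Q (loc_den a)) (\pi_(localization Q) a)).
  rewrite loc_mulE; apply: (loc_pi_eq (loc_notin1 Q)) => /=; ring.
Qed.

(** This elementwise description makes the localization disappear from the rest
of the proof. *)
Lemma symbolic_powerP n f :
  Sy n f <-> exists2 s, s \notin Q & E n (s * f).
Proof.
split=> [/loc_span_clear[s sQ [e Ee]]|[s sQ Esf]].
  rewrite -rmorphM => /eqmodP/asboolP[u uQ /=]; rewrite !mulr1 => eu.
  exists (u * s); first exact: loc_notinM.
  have -> : u * s * f = u * e by apply/eqP; rewrite -subr_eq0 -mulrA -mulrBr eu.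
  exact: ideal_exp_scale.
rewrite /symbolic_power /=.
have -> : loc_map Q f = \pi_(localization Q) (LocPair 1 sQ) * loc_map Q (s * f).
  rewrite -[RHS]/(loc_mul (\pi_(localization Q) (LocPair 1 sQ))
                          (loc_map Q (s * f))).
  rewrite loc_mulE; apply: (loc_pi_eq (loc_notin1 Q)) => /=; ring.
by apply: ideal_span_mul; exists (s * f).
Qed.

Lemma symbolic_power_exp n f : E n f -> Sy n f.
Proof.
move=> Ef; apply/symbolic_powerP; exists 1; first exact: loc_notin1.
by rewrite mul1r.
Qed.

Lemma symbolic_power_add n f g : Sy n f -> Sy n g -> Sy n (f + g).
Proof.
move=> /symbolic_powerP[s sQ Es] /symbolic_powerP[t tQ Et].
apply/symbolic_powerP; exists (s * t); first exact: loc_notinM.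
rewrite mulrDr -mulrA mulrCA -mulrA.
by apply: ideal_exp_add; apply: ideal_exp_scale.
Qed.

Lemma symbolic_power_scale n a f : Sy n f -> Sy n (a * f).
Proof.
move=> /symbolic_powerP[s sQ Es]; apply/symbolic_powerP; exists s => //.
by rewrite mulrCA; apply: ideal_exp_scale.
Qed.

Lemma symbolic_power_opp n f : Sy n f -> Sy n (- f).
Proof. by rewrite -mulN1r; apply: symbolic_power_scale. Qed.

Lemma symbolic_power_sub n f g : Sy n f -> Sy n g -> Sy n (f - g).
Proof.
by move=> Sf Sg; apply: symbolic_power_add => //; apply: symbolic_power_opp.
Qed.

Lemma symbolic_power_cancel n s f : s \notin Q -> Sy n (s * f) -> Sy n f.
Proof.
move=> sQ /symbolic_powerP[t tQ Et]; apply/symbolic_powerP.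
by exists (t * s); [apply: loc_notinM | rewrite -mulrA].
Qed.

Lemma symbolic_power_mul n x f : x \in Q -> Sy n f -> Sy n.+1 (x * f).
Proof.
move=> xQ /symbolic_powerP[s sQ Es]; apply/symbolic_powerP; exists s => //.
by rewrite mulrCA; apply: ideal_exp_mul.
Qed.

Lemma symbolic_power_mulX n k x f :
  x \in Q -> Sy n f -> Sy (k + n) (x ^+ k * f).
Proof.
move=> xQ Sf; elim: k => [|k IH]; first by rewrite mul1r.
by rewrite exprS -mulrA addSn; apply: symbolic_power_mul.
Qed.

Lemma symbolic_power_le m n f : (m <= n)%N -> Sy n f -> Sy m f.
Proof.
move=> mn /symbolic_powerP[s sQ Es]; apply/symbolic_powerP; exists s => //.
exact: ideal_exp_le Es.
Qed.

Lemma ideal_exp1_prime f : E 1 f -> f \in Q.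
Proof.
elim/ideal_exp_ind => [|g h gQ hQ|x g xQ _]; first exact: idealr0.
  exact: rpredD.
by rewrite mulrC idealMr.
Qed.

Lemma symbolic_power1 f : Sy 1 f <-> f \in Q.
Proof.
split=> [/symbolic_powerP[s sQ /ideal_exp1_prime]|fQ].
  exact: prime_notin_mulr.
rewrite -[f]mulr1; apply: symbolic_power_mul => //.
exact: symbolic_power_exp.
Qed.

End SymbolicPowers.

(** * p-derivations *)

(** The factor x * y in the error term makes the failure of additivity of delta
as small as the product of its two arguments. *)
Lemma exprDn_prime (R : comNzRingType) p (x y : R) : prime p ->
  exists r, (x + y) ^+ p = x ^+ p + y ^+ p + p%:R * (x * y * r).
Proof.
case: p => [|[|p]] // p_pr.
exists (\sum_(i < p.+1) (x ^+ (p - i) * y ^+ i) *+ ('C(p.+2, i.+1) %/ p.+2)).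
rewrite exprDn big_ord_recr big_ord_recl /=.
rewrite subn0 subnn bin0 binn !mulr1n expr0 mulr1 mul1r.
rewrite addrAC; congr (_ + _).
rewrite !mulr_sumr; apply: eq_bigr => i _ /=; rewrite /bump leq0n add1n.
have lip := ltn_ord i.
rewrite -{1}(divnK (prime_dvd_bin (k := i.+1) p_pr _)); last by lia.
rewrite mulrnA -[in LHS]mulr_natl; congr (_ * _).
rewrite !mulrnAr; congr (_ *+ _).
have -> : (p.+2 - i.+1 = (p - i).+1)%N by lia.
by rewrite !exprS; ring.
Qed.

Section PDerivation.
Variables (R : comNzRingType) (p : nat) (p_prime : prime p).
Variables (p_regular : forall x : R, p%:R * x = 0 -> x = 0).
Variables (delta : R -> R) (delta_p : is_p_derivation p delta).
Implicit Types x y u v : R.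

Local Notation phi x := (x ^+ p + p%:R * delta x).

Let p_mulI x y : p%:R * x = p%:R * y -> x = y.
Proof.
move=> e; apply/eqP; rewrite -subr_eq0; apply/eqP/p_regular.
by rewrite mulrBr e subrr.
Qed.

Lemma p_derivation0 : delta 0 = 0.
Proof.
apply: p_regular; case: delta_p => phiB _.
have := phiB 0 0; rewrite !subrr.
by rewrite expr0n eqn0Ngt prime_gt0 //= add0r.
Qed.

Lemma p_derivation_phiD x y : phi (x + y) = phi x + phi y.
Proof.
case: delta_p => phiB _; have := phiB (x + y) y; rewrite addrK => ->.
by rewrite subrK.
Qed.

Lemma p_derivationD x y :
  exists r, delta (x + y) = delta x + delta y - x * y * r.
Proof.
have [r er] := exprDn_prime x y p_prime; exists r; apply: p_mulI.
have /(congr1 (fun z => z - (x + y) ^+ p)) := p_derivation_phiD x y.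
by rewrite addrC addKr er => ->; ring.
Qed.

Lemma p_derivationM x y :
  delta (x * y) = phi x * delta y + y ^+ p * delta x.
Proof.
case: delta_p => _ [_ phiM]; apply: p_mulI.
have /(congr1 (fun z => z - (x * y) ^+ p)) := phiM x y.
by rewrite /= addrC addKr => ->; rewrite exprMn; ring.
Qed.

(** Since phi fixes p, dividing phi(p^(k+1) u) - (p^(k+1) u)^p by p removes
exactly one factor p, and the new cofactor is u^p modulo p. *)
Lemma p_derivation_natM k u :
  exists w, delta (p%:R ^+ k.+1 * u) = p%:R ^+ k * (u ^+ p + p%:R * w).
Proof.
case: delta_p => phiB [phi1 phiM].
have phip : forall m, phi (m%:R : R) = m%:R.
  elim=> [|m IH]; last by rewrite -natr1 p_derivation_phiD IH phi1.
  by rewrite p_derivation0 mulr0 addr0 expr0n eqn0Ngt prime_gt0.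
have phipX : forall m, phi ((p%:R : R) ^+ m) = p%:R ^+ m.
  elim=> [|m IH]; first by rewrite expr0 phi1.
  by rewrite exprS; have := phiM p%:R (p%:R ^+ m); rewrite /= phip IH.
have [q eq_p] : exists q, p = q.+2 by case: (p) p_prime => [|[|q]] //; exists q.
exists (delta u - p%:R ^+ (k * q.+1 + q) * u ^+ p); apply: p_mulI.
have /(congr1 (fun z => z - (p%:R ^+ k.+1 * u) ^+ p)) := phiM (p%:R ^+ k.+1) u.
rewrite /= addrC addKr => ->; rewrite phipX exprMn -exprM.
have -> : (k.+1 * p = k + (k * q.+1 + q).+2)%N by rewrite eq_p; lia.
by rewrite exprD !exprS; ring.
Qed.

Variables (Q : prime_idealr R) (pQ : p%:R \in Q).
Local Notation E := (ideal_exp [set` Q]).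
Local Notation Sy := (symbolic_power Q).

(** Modulo p, which lies in Q, phi is the p-th power map. *)
Lemma prime_phi x : (phi x \in Q) = (x \in Q).
Proof.
rewrite rpredDr; last by rewrite mulrC idealMr.
apply/idP/idP => [|xQ]; first by apply: contraTT; apply: prime_notinX.
by rewrite -(prednK (prime_gt0 p_prime)) exprSr idealMr.
Qed.

Lemma p_derivation_ideal_exp n x : E n.+1 x -> E n (delta x).
Proof.
move=> Ex; suff: E n x /\ E n (delta x) by case.
elim: n x Ex => [//|n IH]; apply: ideal_exp_ind.
- by rewrite p_derivation0; split; apply: ideal_exp0.
- move=> x y [Ex Edx] [Ey Edy]; split; first exact: ideal_exp_add.
  have [r ->] := p_derivationD x y; rewrite [x * y * r]mulrC.
  by apply: ideal_exp_add; [apply: ideal_exp_add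
    | apply/ideal_exp_opp/ideal_exp_scale/ideal_exp_scale].
- move=> x y xQ Ey; split; first exact/ideal_exp_scale.
  rewrite p_derivationM; apply: ideal_exp_add; last first.
    rewrite -(prednK (prime_gt0 p_prime)) exprS -mulrA mulrC.
    exact/ideal_exp_scale.
  apply: ideal_exp_mul; first by rewrite /= prime_phi.
  by case: (IH y Ey).
Qed.

(** In delta(s x) = phi(s) delta(x) + x^p delta(s) the last term is as deep as
x and phi(s) is outside Q when s is, so phi(s) can be cancelled. *)
Lemma p_derivation_symbolic n x : Sy n.+1 x -> Sy n (delta x).
Proof.
move=> Sx; case/symbolic_powerP: (Sx) => s sQ /p_derivation_ideal_exp.
rewrite p_derivationM => Edx.
have phisQ : phi s \notin Q by rewrite prime_phi.
apply: (symbolic_power_cancel phisQ).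
rewrite -[X in Sy n X](addrK (x ^+ p * delta s)).
apply: symbolic_power_sub; first exact: symbolic_power_exp.
rewrite -(prednK (prime_gt0 p_prime)) exprSr -mulrA mulrCA mulrC -mulrA.
by do 2?[apply: symbolic_power_scale]; apply: symbolic_power_le Sx.
Qed.

Lemma iter_p_derivation_symbolic n a x :
  Sy (a + n) x -> Sy n (iter a delta x).
Proof.
elim: a n => // a IH n Sx; rewrite iterS.
by apply/p_derivation_symbolic/IH; rewrite addnS.
Qed.

(** Each application of delta removes one factor p and replaces u by u^p modulo
p, while the depth of v decreases by one, so membership in Q is decided by u.
*)
Lemma iter_p_derivation_detect n u v :
  Sy n.+1 v -> iter n delta (p%:R ^+ n * u + v) \in Q -> u \in Q.
Proof.
elim: n u v => [|n IH] u v Sv.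
  rewrite mul1r /= rpredDr //; exact/symbolic_power1.
rewrite iterSr.
have [r ->] := p_derivationD (p%:R ^+ n.+1 * u) v.
have [w ->] := p_derivation_natM n u; rewrite -addrA => /IH {IH} upQ.
suff: phi u \in Q by rewrite prime_phi.
rewrite rpredDr; last by rewrite mulrC idealMr.
suff: u ^+ p + p%:R * w \in Q by rewrite rpredDr // mulrC idealMr.
apply: upQ; apply: symbolic_power_sub; first exact: p_derivation_symbolic.
rewrite [_ * r]mulrC; apply/symbolic_power_scale/symbolic_power_scale.
exact: symbolic_power_le Sv.
Qed.

End PDerivation.

(** * Differential operators and mixed powers *)

Section DifferentialOperators.
Variables (A : comNzRingType) (R : comAlgType A).
Implicit Types (r x y : R) (D : R -> R).
Local Notation diffop := (@diffop A R).

Lemma diffop_linear b D : diffop b D -> linear D.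
Proof.
case: b => [[r ->] a x y|b [] //]; by rewrite mulrDr scalerAr.
Qed.

Lemma diffop_commutator b D r :
  diffop b.+1 D -> diffop b (fun x => D (r * x) - r * D x).
Proof. by case=> _; apply; exists r. Qed.

Lemma diffop_mull b D r : diffop b D -> diffop b (fun x => r * D x).
Proof.
elim: b D => [|b IH] D dD.
  case: dD => s ->; exists (r * s); apply/funext => x; exact: mulrA.
split=> [a x y|_ [s ->]].
  by rewrite (diffop_linear dD) mulrDr scalerAr.
have := IH _ (diffop_commutator s dD); congr diffop.
by apply/funext => x; ring.
Qed.

Lemma diffop_mulr b D r : diffop b D -> diffop b (fun x => D (r * x)).
Proof.
elim: b D => [|b IH] D dD.
  case: dD => s ->; exists (s * r); apply/funext => x; exact: mulrA.
split=> [a x y|_ [s ->]].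
  by rewrite mulrDr -scalerAr (diffop_linear dD).
have := IH _ (diffop_commutator s dD); congr diffop.
by apply/funext => x; rewrite mulrCA.
Qed.

Lemma diffop_add b D D' :
  diffop b D -> diffop b D' -> diffop b (fun x => D x + D' x).
Proof.
elim: b D D' => [|b IH] D D' dD dD'.
  case: dD dD' => [s ->] [t ->]; exists (s + t).
  by apply/funext => x; rewrite mulrDl.
split=> [a x y|_ [s ->]].
  by rewrite (diffop_linear dD) (diffop_linear dD') scalerDr addrACA.
have := IH _ _ (diffop_commutator s dD) (diffop_commutator s dD').
by congr diffop; apply/funext => x; ring.
Qed.

Lemma diffop0 b : diffop b (fun=> 0).
Proof.
elim: b => [|b IH]; first by exists 0; apply/funext => x; rewrite mul0r.
split=> [a x y|_ [s ->]]; first by rewrite scaler0 addr0.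
by have := IH; congr diffop; apply/funext => x; rewrite mulr0 subr0.
Qed.

Lemma diffop_leS b D : diffop b D -> diffop b.+1 D.
Proof.
elim: b D => [|b IH] D dD; split; try exact: diffop_linear dD.
  move=> _ [s ->]; case: dD => t ->; exists 0.
  by apply/funext => x; ring.
by move=> _ [s ->]; apply/IH/diffop_commutator.
Qed.

Lemma diffop_le b c D : (b <= c)%N -> diffop b D -> diffop c D.
Proof.
move=> /subnK <-; elim: (c - b)%N => // k IH dD.
by rewrite addSn; apply/diffop_leS/IH.
Qed.

(** The commutator of D D' with s is [D, s] D' + D [D', s], which gives an
induction on the total order. *)
Lemma diffop_comp b c D D' :
  diffop b D -> diffop c D' -> diffop (b + c) (fun x => D (D' x)).
Proof.
move: {2}(b + c)%N (leqnn (b + c)) => N.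
elim: N b c D D' => [|N IH] b c D D'.
  rewrite leqn0 addn_eq0 => /andP[/eqP-> /eqP->] [s ->] dD'.
  exact: diffop_mull.
case: b => [|b] leN dD dD'; first by case: dD => s ->; apply: diffop_mull.
case: c dD' leN => [|c] dD' leN.
  by rewrite addn0; case: dD' => s ->; apply: diffop_mulr.
split=> [a x y|_ [s ->]].
  by rewrite (diffop_linear dD') (diffop_linear dD).
have d1 := IH b c.+1 _ _ leN (diffop_commutator s dD) dD'.
have d2 := IH b.+1 c _ _ _ dD (diffop_commutator s dD').
rewrite addSnnS in d2.
have {d1 d2} := diffop_add d1 (d2 ltac:(lia)); congr diffop; apply/funext => x.
have DB y z : D (y - z) = D y - D z.
  by rewrite addrC -scaleN1r (diffop_linear dD) scaleN1r addrC.
by rewrite DB; ring.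
Qed.

(** In D(y z) = y D(z) + [D, y](z) with y in B, the first term keeps the factor
y and the operator in the second has smaller order. *)
Lemma diffop_ideal_exp (B : set R) b D n x :
  diffop b D -> ideal_exp B n x -> ideal_exp B (n - b) (D x).
Proof.
elim: b n D x => [|b IHb] n D x dD.
  by case: dD => s -> Ex; rewrite subn0; apply: ideal_exp_scale.
have [DD D0] : (forall y z, D (y + z) = D y + D z) /\ D 0 = 0.
  have DD y z : D (y + z) = D y + D z.
    by rewrite -[y]scale1r (diffop_linear dD) !scale1r.
  by split=> //; apply: (addrI (D 0)); rewrite -DD !addr0.
elim: n x => [//|n IHn]; apply: ideal_exp_ind.
- rewrite D0; exact: ideal_exp0.
- by move=> y z Ey Ez; rewrite DD; apply: ideal_exp_add.
move=> y z By Ez; rewrite -[D _](subrK (y * D z)); apply: ideal_exp_add.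
  by rewrite subSS; apply: (IHb n _ _ (diffop_commutator y dD)).
have [leb|ltb] := leqP b.+1 n; last by rewrite (eqP (_ : n.+1 - b.+1 == 0)%N).
by rewrite subSn //; apply: ideal_exp_mul => //; apply: IHn.
Qed.

Variables (Q : prime_idealr R).
Local Notation Sy := (symbolic_power Q).

Lemma diffop_symbolic b D n x : diffop b D -> Sy n x -> Sy (n - b) (D x).
Proof.
elim: b n D x => [|b IHb] n D x dD Sx.
  by case: dD => s ->; rewrite subn0; apply: symbolic_power_scale.
have /symbolic_powerP[s sQ Esx] := Sx; apply: (symbolic_power_cancel sQ).
rewrite -[s * D x](subKr (D (s * x))); apply: symbolic_power_sub.
  exact/symbolic_power_exp/diffop_ideal_exp.
apply: symbolic_power_le (IHb n _ _ (diffop_commutator s dD) Sx); lia.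
Qed.

Variable delta : R -> R.
Local Notation mix := (mixed_power A delta [set` Q]).

Lemma mixed_power_le m n x : (m <= n)%N -> mix n x -> mix m x.
Proof. by move=> mn hx a b D ab; apply: hx; apply: leq_trans mn. Qed.

(** Precomposition with a multiplication preserves the order of an operator; no
product rule for delta is involved. *)
Lemma mixed_power_scale n r x : mix n x -> mix n (r * x).
Proof. by move=> hx a b D ab /(diffop_mulr r) dD; apply: (hx a b _ ab dD). Qed.

Lemma mixed_power_diffop b D n x : diffop b D -> mix n x -> mix (n - b) (D x).
Proof.
move=> dD hx a c D' ac dD'.
by apply: (hx a (c + b)%N _ _ (diffop_comp dD' dD)); lia.
Qed.

Lemma mixed_power_iter n x : mix n.+1 x -> iter n delta x \in Q.
Proof.
move=> hx; apply: (hx n 0%N id); first by rewrite addn0.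
by exists 1; apply/funext => y; rewrite mul1r.
Qed.

End DifferentialOperators.

Theorem symbolic_sub_mixed (A : comNzRingType) (R : comAlgType A) p
    (delta : R -> R) (Q : prime_idealr R) n :
    prime p -> (forall x : R, p%:R * x = 0 -> x = 0) ->
    is_p_derivation p delta -> p%:R \in Q ->
  symbolic_power Q n `<=` mixed_power A delta [set` Q] n.
Proof.
move=> p_pr p_reg dp pQ x Sx a b D ab dD; apply/symbolic_power1.
apply: (iter_p_derivation_symbolic p_pr p_reg dp pQ).
apply: symbolic_power_le (diffop_symbolic dD Sx); lia.
Qed.

(** * Subrings of polynomials and Hasse derivatives *)

Section Polynomials.
Variables (A : comNzRingType) (d : nat).
Local Notation R := {mpoly A[d]}.
Implicit Types (f g : R) (i j : 'I_d) (S : {set 'I_d}).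

Lemma mpoly_ring_ind (K : R -> Prop) :
    (forall c, K c%:MP) -> (forall i, K 'X_i) ->
    (forall f g, K f -> K g -> K (f + g)) ->
    (forall f g, K f -> K g -> K (f * g)) ->
  forall f, K f.
Proof.
move=> KC KX KD KM; elim/mpolyind => [|c m f _ _ Kf]; first exact: (KC 0).
apply: (KD) => //; rewrite -mul_mpolyC; apply: (KM) => //.
rewrite mpolyXE_id; elim/big_ind: _ => // [|i _]; first exact: (KC 1).
by elim: (m i) => [|k IH]; [apply: (KC 1) | rewrite exprS; apply: KM].
Qed.

Lemma mpoly_rmorph_ext (T : nzRingType) (F G : {rmorphism R -> T}) :
    (forall c, F c%:MP = G c%:MP) -> (forall i, F 'X_i = G 'X_i) ->
  forall f, F f = G f.
Proof.
move=> FGC FGX; apply: mpoly_ring_ind => // f g ef eg.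
  by rewrite !rmorphD ef eg.
by rewrite !rmorphM ef eg.
Qed.

(** The subring of polynomials in the variables with index in S, as a
predicate, so that all these subrings live in one polynomial ring. *)
Definition vars_in S : pred R :=
  fun f => all (fun m : 'X_{1..d} => [forall i, (m i != 0%N) ==> (i \in S)])
               (msupp f).

Lemma vars_inP S f :
  reflect (forall m i, f@_m != 0 -> m i != 0%N -> i \in S) (f \in vars_in S).
Proof.
apply: (iffP allP) => [fS m i|fS m]; rewrite -?mcoeff_msupp.
  by move=> /fS /forallP/(_ i)/implyP.
by rewrite mcoeff_msupp => fm; apply/forallP => i; apply/implyP; apply: fS.
Qed.

Lemma vars_in_subring S : subring_closed (vars_in S).
Proof.
split=> [|f g /vars_inP fS /vars_inP gS|f g /vars_inP fS /vars_inP gS].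
- apply/vars_inP => m i; rewrite mcoeff1.
  by have [->|_] := eqVneq m 0%MM; rewrite ?mnm0E ?eqxx.
- apply/vars_inP => m i; rewrite mcoeffB.
  have [->|fm _] := eqVneq f@_m 0; last exact: fS.
  by rewrite sub0r oppr_eq0; apply: gS.
apply/vars_inP => m i; rewrite mcoeffM => fgm mi.
apply: contraNT fgm => iS; apply/eqP/big1 => -[m1 m2] /= /eqP em.
have [->|f1] := eqVneq f@_m1 0; first by rewrite mul0r.
have [->|g2] := eqVneq g@_m2 0; first by rewrite mulr0.
have : (m1 + m2)%MM i != 0%N by rewrite -em.
rewrite mnmDE addn_eq0.
have [_|m1i] := eqVneq (m1 i) 0%N; last by rewrite (fS _ _ f1 m1i) in iS.
have [_|m2i] := eqVneq (m2 i) 0%N; last by rewrite (gS _ _ g2 m2i) in iS.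
by [].
Qed.

HB.instance Definition _ S :=
  GRing.isSubringClosed.Build R (vars_in S) (vars_in_subring S).

Lemma vars_inC S c : c%:MP \in vars_in S.
Proof.
apply/vars_inP => m i; rewrite mcoeffC.
by have [->|_] := eqVneq m 0%MM; rewrite ?mnm0E // mulr0 eqxx.
Qed.

Lemma vars_inX S i : i \in S -> 'X_i \in vars_in S.
Proof.
move=> iS; apply/vars_inP => m j; rewrite mcoeffX.
have [<- _|_] := eqVneq U_(i)%MM m; last by rewrite eqxx.
by rewrite mnm1E eqb0 negbK => /eqP <-.
Qed.

Lemma vars_inT f : f \in vars_in [set: 'I_d].
Proof. by apply/vars_inP => m i; rewrite inE. Qed.

(** The substitution of x_i + T for x_i; its coefficients in T are the Hasse
derivatives along x_i. *)
Definition taylor i : R -> {poly R} :=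
  mmap (polyC \o @mpolyC d A) (fun j => ('X_j)%:P + (i == j)%:R * 'X).

HB.instance Definition _ i := GRing.RMorphism.on (taylor i).

Definition hasse i b f : R := (taylor i f)`_b.

(** A polynomial seen as a univariate one in x_i, with coefficients in the same
ring (where they do not involve x_i). *)
Definition expand i : R -> {poly R} :=
  mmap (polyC \o @mpolyC d A) (fun j => if i == j then 'X else ('X_j)%:P).

HB.instance Definition _ i := GRing.RMorphism.on (expand i).

Lemma taylorC i c : taylor i c%:MP = c%:MP%:P.
Proof. by rewrite /taylor mmapC. Qed.

Lemma taylorX i j : taylor i 'X_j = ('X_j)%:P + (i == j)%:R * 'X.
Proof. by rewrite /taylor mmapX mmap1U. Qed.

Lemma taylor_free S i f : f \in vars_in S -> i \notin S -> taylor i f = f%:P.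
Proof.
move=> /vars_inP fS iS; rewrite {2}[f]mpolyE rmorph_sum /= /taylor /mmap.
rewrite !big_seq; apply: eq_bigr => m; rewrite mcoeff_msupp => fm.
rewrite -mul_mpolyC rmorphM /=; congr (_ * _).
rewrite mpolyXE_id rmorph_prod /mmap1 /=; apply: eq_bigr => j _.
rewrite rmorphXn /=; have [ij|_] := eqVneq i j; last by rewrite mul0r addr0.
have [->|/(fS _ _ fm)] := eqVneq (m j) 0%N; first by rewrite !expr0.
by rewrite -ij (negPf iS).
Qed.

Opaque taylor.

Lemma expandK i f : (expand i f).['X_i] = f.
Proof.
apply: (mpoly_rmorph_ext (F := horner_eval 'X_i \o expand i) (G := idfun)).
  by move=> c; rewrite /= /horner_eval /expand mmapC hornerC.
move=> j; rewrite /= /horner_eval /expand mmapX mmap1U.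
by case: eqP => [->|_]; rewrite ?hornerX ?hornerC.
Qed.

Lemma expand_over S i f : f \in vars_in S ->
  expand i f \is a polyOver (vars_in (S :\ i)).
Proof.
move=> /vars_inP fS; rewrite /expand /mmap big_seq; apply: rpred_sum => m.
rewrite mcoeff_msupp => fm; apply: rpredM.
  by rewrite polyOverC; apply: vars_inC.
apply: rpred_prod => j _; have [ij|ij] := eqVneq i j.
  by apply: rpredX; apply: polyOverX.
have [->|/(fS _ _ fm) jS] := eqVneq (m j) 0%N; first by rewrite expr0 rpred1.
by apply: rpredX; rewrite polyOverC; apply: vars_inX; rewrite !inE eq_sym ij.
Qed.

Lemma hasseD i b f g : hasse i b (f + g) = hasse i b f + hasse i b g.
Proof. by rewrite /hasse rmorphD coefD. Qed.

Lemma hasse_zero i b : hasse i b 0 = 0.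
Proof. by rewrite /hasse rmorph0 coef0. Qed.

Lemma hasse0 i f : hasse i 0 f = f.
Proof.
rewrite /hasse -horner_coef0.
apply: (mpoly_rmorph_ext (F := horner_eval 0 \o taylor i) (G := idfun)).
  by move=> c; rewrite /= /horner_eval taylorC hornerC.
move=> j; rewrite /= /horner_eval taylorX hornerD hornerM hornerX mulr0.
by rewrite hornerC addr0.
Qed.

Lemma hasse_free S i b f g : f \in vars_in S -> i \notin S ->
  hasse i b (f * g) = f * hasse i b g.
Proof.
by move=> fS iS; rewrite /hasse rmorphM /= (taylor_free fS iS) coefCM.
Qed.

Lemma hasseM i b f g :
  hasse i b (f * g) = \sum_(u < b.+1) hasse i u f * hasse i (b - u) g.
Proof. by rewrite /hasse rmorphM coefM. Qed.

Lemma hasse1M i f g : hasse i 1 (f * g) = f * hasse i 1 g + hasse i 1 f * g.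
Proof.
by rewrite hasseM big_ord_recl big_ord1 subn0 subnn (hasse0 i f) (hasse0 i g).
Qed.

Lemma hasse1_mderiv i f : hasse i 1 f = f^`M(i).
Proof.
move: f; apply: mpoly_ring_ind.
- by move=> c; rewrite /hasse taylorC coefC mderivC.
- move=> j; rewrite /hasse taylorX coefD coefC add0r coefMX coefMn.
  rewrite coef1 /= mderivX mnm1E [j == i]eq_sym.
  have [->|_] := eqVneq i j; last by rewrite scale0r.
  rewrite scale1r (_ : (_ - _)%MM = 0%MM) ?mpolyX0 //.
  by apply/mnmP => k; rewrite mnmBE subnn mnm0E.
- by move=> f g ef eg; rewrite hasseD mderivD ef eg.
- by move=> f g ef eg; rewrite hasse1M mderivM ef eg addrC.
Qed.

(** By the product rule, the commutator of the Hasse derivative of order b with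
s is a combination of Hasse derivatives of order less than b. *)
Lemma hasse_diffop i b : diffop (A := A) b (hasse i b : R -> R).
Proof.
have [N] := ubnP b; elim: N b => // N IH b; rewrite ltnS => bN.
case: b bN => [|b] bN.
  by exists 1; apply/funext => f; rewrite hasse0 mul1r.
split=> [c f g|_ [s ->]].
  rewrite hasseD -mul_mpolyC (hasse_free _ _ (vars_inC finset.set0 c)) ?inE //.
  by rewrite mul_mpolyC.
have -> : (fun x => hasse i b.+1 (s * x) - s * hasse i b.+1 x) =
    (fun x => \sum_(u < b.+1) hasse i u.+1 s * hasse i (b - u) x).
  apply/funext => x; rewrite hasseM big_ord_recl hasse0 subn0.
  rewrite addrAC subrr add0r.
  by apply: eq_bigr => u _.
have sumdiff (I : Type) (r : seq I) (D : I -> R -> R) :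
    (forall u, diffop (A := A) b (D u)) ->
    diffop (A := A) b (fun x => \sum_(u <- r) D u x).
  move=> dD; elim: r => [|u r IHr].
    by have := diffop0 R b; congr diffop; apply/funext => x; rewrite big_nil.
  have := diffop_add (dD u) IHr.
  by congr diffop; apply/funext => x; rewrite big_cons.
apply: sumdiff => u; apply: diffop_mull.
by apply: (@diffop_le _ _ (b - u)%N); [lia | apply: IH; lia].
Qed.

Variable (Q : prime_idealr R).

Lemma horner_prime (P : {poly R}) x : (forall k, P`_k \in Q) -> P.[x] \in Q.
Proof.
move=> PQ; rewrite horner_coef; apply: rpred_sum => k _.
by rewrite mulrC idealMr.
Qed.

(** Modulo Q, P is divisible by T, so P^b C starts in degree b with the product
of the leading coefficients. *)
Lemma coef_exp_lead (P C : {poly R}) b : P`_0 \in Q ->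
  (forall k, (k < b)%N -> (P ^+ b * C)`_k \in Q) /\
  (P ^+ b * C)`_b - P`_1 ^+ b * C`_0 \in Q.
Proof.
move=> P0; elim: b => [|b [IHlt IHb]].
  by split=> //; rewrite !mul1r subrr idealr0.
have step k : (k <= b)%N ->
    (P ^+ b.+1 * C)`_k.+1 - P`_1 * (P ^+ b * C)`_k \in Q.
  move=> kb; rewrite exprS -mulrA coefM !big_ord_recl /= subn0 subSS subn0.
  rewrite -addrA [X in _ + X]addrAC subrr add0r; apply: rpredD.
    by rewrite mulrC idealMr.
  apply: rpred_sum => l _; apply: idealMr.
  by apply: IHlt; rewrite /bump /=; have := ltn_ord l; lia.
split=> [[_|k]|].
- by rewrite exprS -mulrA coefM big_ord1 mulrC idealMr.
- rewrite ltnS => kb; rewrite -[X in X \in _](subrK (P`_1 * (P ^+ b * C)`_k)).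
  by apply: rpredD; [apply: step; lia | apply/idealMr/IHlt].
rewrite -[X in X \in _](subrKA (P`_1 * (P ^+ b * C)`_b)).
apply: rpredD; first exact: step.
by rewrite exprS -mulrA -mulrBr; apply: idealMr.
Qed.

Lemma hasse_exp i b m c : m \in Q ->
  hasse i b (m ^+ b * c) - hasse i 1 m ^+ b * c \in Q.
Proof.
move=> mQ; rewrite /hasse rmorphM rmorphXn /= -[X in _ - _ * X](hasse0 i c).
by apply: (coef_exp_lead _ _ _).2; rewrite -/(hasse i 0 m) hasse0.
Qed.

End Polynomials.

#[global] Opaque taylor hasse expand.

(** * A separable generator for one variable *)

Section Elimination.
Variables (A : comNzRingType) (d : nat) (Q : prime_idealr {mpoly A[d]}).
Local Notation R := {mpoly A[d]}.
Implicit Types (f g : R) (i j : 'I_d) (S : {set 'I_d}) (P : {poly R}).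

Definition contraction S : set R := [set f | f \in Q /\ f \in vars_in S].

(** An algebraic relation of x_i, modulo Q, over the variables of S other than
x_i: its coefficients do not all vanish modulo Q. *)
Definition nonzero_relation S i P : Prop :=
  [/\ P \is a polyOver (vars_in (S :\ i)), P.['X_i] \in Q
     & exists k, P`_k \notin Q].

(** Division works up to a multiplier outside Q since the leading coefficient
of the divisor is outside Q. *)
Lemma pseudo_division S i P P1 :
    P != 0 -> lead_coef P \notin Q ->
    P \is a polyOver (vars_in (S :\ i)) ->
    P1 \is a polyOver (vars_in (S :\ i)) ->
  exists s, s \notin Q /\ exists U N, [/\ s *: P1 = U * P + N,
    N \is a polyOver (vars_in (S :\ i)) & (size N < size P)%N].
Proof.
move=> P0 lcQ PF; have [n] := ubnP (size P1); elim: n P1 => // n IH P1.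
rewrite ltnS => szn P1F; have [ltP|leP] := ltnP (size P1) (size P).
  exists 1; split; first exact: loc_notin1.
  by exists 0, P1; rewrite scale1r mul0r add0r.
pose k := (size P1 - size P)%N.
pose P2 := lead_coef P *: P1 - lead_coef P1 *: ('X^k * P).
have szP : (0 < size P)%N by rewrite size_poly_gt0.
have lcF P' : P' \is a polyOver (vars_in (S :\ i)) ->
    lead_coef P' \in vars_in (S :\ i).
  by move=> /polyOverP; apply.
have [||s [sQ [U [N [eN NF szN]]]]] := IH P2.
- apply: leq_trans szn; rewrite -(prednK (leq_trans szP leP)) ltnS.
  apply/leq_sizeP => j; rewrite leq_eqVlt => /orP[/eqP <-|ltj].
    rewrite coefB !coefZ coefXnM /k ltnNge.
    have -> /= : (size P1 - size P <= (size P1).-1)%N by lia.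
    have -> : ((size P1).-1 - (size P1 - size P) = (size P).-1)%N by lia.
    by rewrite !lead_coefE mulrC subrr.
  rewrite coefB !coefZ coefXnM /k ltnNge.
  have -> /= : (size P1 - size P <= j)%N by lia.
  have P1j : (size P1 <= j)%N by lia.
  have Pj : (size P <= j - (size P1 - size P))%N by lia.
  by rewrite [P1`_j]nth_default // [P`__]nth_default // !mulr0 subrr.
- apply: rpredB; first by apply: polyOverZ => //; apply: lcF.
  apply: polyOverZ; first exact: lcF.
  by apply: rpredM => //; apply/rpredX/polyOverX.
exists (s * lead_coef P); split; first exact: loc_notinM.
exists (U + (s * lead_coef P1) *: 'X^k), N; split=> //.
have -> : (s * lead_coef P) *: P1 = s *: P2 + (s * lead_coef P1) *: ('X^k * P).
  by rewrite /P2 scalerBr !scalerA subrK.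
by rewrite eN mulrDl scalerAl addrAC.
Qed.

(** If the leading coefficient of a relation were in Q, dropping the leading
term would give a shorter relation. *)
Lemma minimal_relation S i P : nonzero_relation S i P ->
  exists M, [/\ nonzero_relation S i M, lead_coef M \notin Q &
    forall N, N \is a polyOver (vars_in (S :\ i)) -> N.['X_i] \in Q ->
      (size N < size M)%N -> forall k, N`_k \in Q].
Proof.
move=> relP.
pose has_size n := `[< exists2 N, nonzero_relation S i N & size N = n >].
have ex_size : exists n, has_size n by exists (size P); apply/asboolP; exists P.
case: (ex_minnP ex_size) => n /asboolP[M relM szM] min_n.
have minM N : N \is a polyOver (vars_in (S :\ i)) -> N.['X_i] \in Q ->
    (size N < size M)%N -> forall k, N`_k \in Q.
  move=> NF NQ szN k; apply: contraTT szN => kQ; rewrite -leqNgt szM.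
  by apply: min_n; apply/asboolP; exists N => //; split=> //; exists k.
exists M; split=> //.
have [MF MQ [k kQ]] := relM; apply/negP => lcQ.
have M0 : (0 < size M)%N.
  rewrite lt0n size_poly_eq0; apply: contraNneq kQ => ->.
  by rewrite coef0 idealr0.
have dropQ l : (drop_poly (size M).-1 M)`_l \in Q.
  rewrite coef_drop_poly; case: l => [|l]; first exact: lcQ.
  have szl : (size M <= l.+1 + (size M).-1)%N by lia.
  by rewrite nth_default ?idealr0.
have takeQ : forall l, (take_poly (size M).-1 M)`_l \in Q.
  apply: minM.
  - apply/polyOverP => l; rewrite coef_take_poly.
    by case: ifP => _; [apply: (polyOverP MF) | apply: rpred0].
  - move: MQ; rewrite -{1}(poly_take_drop (size M).-1 M) hornerD rpredDr //.
    by rewrite hornerM mulrC; apply/idealMr/horner_prime.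
  - by rewrite -(prednK M0) ltnS size_take_poly.
move: kQ; rewrite -(poly_take_drop (size M).-1 M) coefD coefMXn.
rewrite rpredDr ?takeQ //; case: ifP => _; [exact: idealr0 | exact: dropQ].
Qed.

Lemma hasse_ideal_exp S i b n c f : i \notin S ->
  ideal_exp (contraction S) n f ->
  ideal_exp (contraction S) n (hasse i b (c * f)).
Proof.
move=> iS; elim: n f => // n IH f; elim/ideal_exp_ind.
- by rewrite mulr0 hasse_zero; apply: ideal_exp0.
- by move=> g h; rewrite mulrDr hasseD; apply: ideal_exp_add.
- move=> x g Bx Eg; rewrite mulrCA (hasse_free _ _ Bx.2 iS).
  exact/ideal_exp_mul/IH.
Qed.

Lemma contraction_sub S : contraction S `<=` [set` Q].
Proof. by move=> f []. Qed.

(** The generator m is the value at x_i of a shortest relation M over R_(S-i).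
The remainder in a pseudo-division by M is too short to be a relation, so its
coefficients are in Q; this gives the generation property. Differentiating s g
= u m + e along x_i shows that dm/dx_i is outside Q, as dg/dx_i is. *)
Lemma separable_generator S i g :
    contraction S g -> hasse i 1 g \notin Q ->
  exists m, [/\ m \in Q, hasse i 1 m \notin Q & forall f, contraction S f ->
    exists2 s, s \notin Q & exists u e,
      ideal_exp (contraction (S :\ i)) 1 e /\ s * f = u * m + e].
Proof.
move=> Bg dgQ.
have smallQ (N : {poly R}) : (forall k, contraction (S :\ i) N`_k) ->
    ideal_exp (contraction (S :\ i)) 1 N.['X_i].
  move=> NB; rewrite horner_coef; elim/big_ind: _ => [||k _].
  - exact: ideal_exp0.
  - by move=> x y; apply: ideal_exp_add.
  - exact: ideal_exp_mul.
have iS' : i \notin S :\ i by rewrite !inE eqxx.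
have smallhQ f b : ideal_exp (contraction (S :\ i)) 1 f -> hasse i b f \in Q.
  move=> /(hasse_ideal_exp b 1 iS'); rewrite mul1r.
  move=> /(ideal_exp_sub (@contraction_sub _)).
  exact: ideal_exp1_prime.
have relg : nonzero_relation S i (expand i g).
  split; [exact: expand_over Bg.2 | by rewrite expandK; case: Bg |].
  apply: contrapT => noc; move/negP: dgQ; apply.
  rewrite -(expandK i g); apply/smallhQ/smallQ => k; split; last first.
    exact: (polyOverP (expand_over i Bg.2)).
  by apply: contrapT => /negP kQ; apply: noc; exists k.
have [M [[MF MQ [k kQ]] lcQ minM]] := minimal_relation relg.
have M0 : M != 0 by apply: contraNneq kQ => ->; rewrite coef0 idealr0.
have gen f : contraction S f -> exists2 s, s \notin Q & exists u e,
    ideal_exp (contraction (S :\ i)) 1 e /\ s * f = u * M.['X_i] + e.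
  move=> [fQ fS].
  have [s [sQ [U [N [eN NF szN]]]]] :=
    pseudo_division M0 lcQ MF (expand_over i fS).
  move/(congr1 (horner_eval 'X_i)): eN.
  rewrite /horner_eval hornerZ expandK hornerD hornerM => eN.
  exists s => //; exists U.['X_i], N.['X_i]; split=> //; apply: smallQ => l.
  split; last exact: (polyOverP NF).
  apply: minM => //; have : s * f \in Q by apply: idealMr.
  by rewrite eN rpredDl // idealMr.
exists M.['X_i]; split; [exact: MQ | apply/negP => dmQ | exact: gen].
have [s sQ [u [e [Ee eg]]]] := gen g Bg.
move/(congr1 (hasse i 1)): eg; rewrite hasseD !hasse1M => eg.
have : s * hasse i 1 g + hasse i 1 s * g \in Q.
  rewrite eg; apply: rpredD; last exact: smallhQ.
  by apply: rpredD; apply: idealMr.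
rewrite rpredDr; last by case: Bg => gQ _; apply: idealMr.
by move/(prime_notin_mulr sQ); apply/negP.
Qed.

End Elimination.

(** * Vanishing derivatives force divisibility by p *)

Section Dichotomy.
Variables (A : comNzRingType) (d p : nat) (p_prime : prime p).
Variables (frobA : forall c : A, exists a, c ^+ p = c + p%:R * a).
Variables (Q : prime_idealr {mpoly A[d]}).
Variables (constQ : forall c : A, c%:MP \in Q -> exists a, c = p%:R * a).
Variables (pQ : p%:R \in Q).
Local Notation R := {mpoly A[d]}.
Implicit Types (f g : R) (i j : 'I_d) (S : {set 'I_d}).

Local Notation pdiv f := (exists r, f = p%:R * r).

Lemma pdiv_add (f g : R) : pdiv f -> pdiv g -> pdiv (f + g).
Proof. by move=> [r ->] [s ->]; exists (r + s); rewrite mulrDr. Qed.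

(** Bezout for the coprime integers k and p. *)
Lemma pdiv_cofactor (c : A) k : ~~ (p %| k)%N -> pdiv (c *+ k) -> pdiv c.
Proof.
rewrite -prime_coprime // => /eqP pk [a ea].
have [u v e _] := egcdnP k (prime_gt0 p_prime); rewrite pk in e.
exists (u%:R * c - v%:R * a); rewrite mulrBr [_ * (v%:R * a)]mulrCA -ea.
rewrite -[c *+ k]mulr_natl !mulrA -!natrM mulnC e natrD mulrDl mul1r.
by rewrite addrAC subrr add0r.
Qed.

Lemma sum_frob (I : Type) (r : seq I) (F : I -> R) :
  pdiv ((\sum_(k <- r) F k) ^+ p - \sum_(k <- r) F k ^+ p).
Proof.
elim: r => [|k r IH].
  by exists 0; rewrite !big_nil expr0n eqn0Ngt prime_gt0 // subrr mulr0.
rewrite !big_cons.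
have [u ->] := exprDn_prime (F k) (\sum_(k <- r) F k) p_prime.
case: IH => s es; exists (s + F k * (\sum_(k <- r) F k) * u).
rewrite mulrDr -es; ring.
Qed.

(** By induction on a bound n for the degree of g, where the constants are
covered by the hypothesis on Q. The derivatives of g have smaller degree, hence
are multiples of p, so only the coefficients of monomials that are p-th powers
survive modulo p. As every coefficient is its own p-th power modulo p, g is the
p-th power modulo p of a polynomial h of smaller degree, and h is in Q because
Q is prime. *)
Lemma contraction_pdiv S :
    (forall i g, i \in S -> contraction Q S g -> hasse i 1 g \in Q) ->
  forall g, contraction Q S g -> pdiv g.
Proof.
move=> hS; suff bounded n : forall g, contraction Q S g ->
    (forall m, g@_m != 0 -> (mdeg m <= n)%N) -> pdiv g.
  move=> g Bg; apply: (bounded (\max_(m <- msupp g) mdeg m)%N) => // m gm.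
  by rewrite (big_rem m) ?mcoeff_msupp //= leq_maxl.
elim: n => [|n IH] g [gQ gS] gn.
  have eg : g = (g@_0%MM)%:MP.
    apply/mpolyP => m; rewrite mcoeffC; have [->|m0] := eqVneq m 0%MM.
      by rewrite mulr1.
    rewrite mulr0; apply/eqP; apply: contraNT m0 => /gn.
    by rewrite leqn0 mdeg_eq0.
  have [a ea] : pdiv (g@_0%MM) by apply: constQ; rewrite -eg.
  by exists a%:MP; rewrite eg ea rmorphM rmorph_nat.
have coefp (m : 'X_{1..d}) i : ~~ (p %| m i)%N -> pdiv (g@_m).
  move=> pmi; have [->|gm] := eqVneq g@_m 0; first by exists 0; rewrite mulr0.
  have mi0 : (0 < m i)%N by rewrite lt0n; apply: contraNneq pmi => ->.
  have iS : i \in S by apply: (vars_inP _ _ gS) gm _; rewrite -lt0n.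
  have [||r er] := IH g^`M(i).
  - split; first by rewrite -hasse1_mderiv; apply: hS.
    apply/vars_inP => k j; rewrite mcoeff_deriv => gk kj.
    have : g@_(k + U_(i)) != 0 by apply: contraNneq gk => ->; rewrite mul0rn.
    by move/(vars_inP _ _ gS); apply; rewrite mnmDE addn_eq0 negb_and kj.
  - move=> k; rewrite mcoeff_deriv => gk.
    rewrite -ltnS -addn1 -(mdeg1 i) -mdegD.
    by apply: gn; apply: contraNneq gk => ->; rewrite mul0rn.
  apply: (pdiv_cofactor pmi); exists (r@_(m - U_(i))).
  move/(congr1 (mcoeff (m - U_(i)))): er.
  rewrite mcoeff_deriv mulr_natl mcoeffMn mulr_natl => <-.
  rewrite mnmBE mnm1E eqxx subn1 prednK //.
  by rewrite submK // lep1mP -lt0n.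
pose dv := fun m : 'X_{1..d} => [forall i, (p %| m i)%N].
pose rt := fun m : 'X_{1..d} => [multinom (m i %/ p)%N | i < d].
pose h := \sum_(m <- msupp g | dv m) g@_m *: 'X_[rt m] : R.
(* The three summands are the monomials that are not p-th powers, the error of
   c^p = c on the coefficients, and the error of additivity of the power. *)
have gh : pdiv (g - h ^+ p).
  have -> : g - h ^+ p = \sum_(m <- msupp g | ~~ dv m) g@_m *: 'X_[m]
     + (\sum_(m <- msupp g | dv m) (g@_m *: 'X_[m] - (g@_m *: 'X_[rt m]) ^+ p))
     + - (h ^+ p - \sum_(m <- msupp g | dv m) (g@_m *: 'X_[rt m]) ^+ p).
    by rewrite {1}[g]mpolyE (bigID dv) /= sumrB; ring.
  have pdiv_sum (I : Type) (r : seq I) (K : pred I) (F : I -> R) :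
      (forall k, K k -> pdiv (F k)) -> pdiv (\sum_(k <- r | K k) F k).
    move=> KF; elim/big_ind: _ => [|x y|//]; last exact: pdiv_add.
    by exists 0; rewrite mulr0.
  apply: pdiv_add; first apply: pdiv_add.
  - apply: (pdiv_sum) => m; rewrite negb_forall => /existsP[i /coefp[a ->]].
    by exists (a *: 'X_[m]); rewrite -scalerA scaler_nat mulr_natl.
  - apply: (pdiv_sum) => m /forallP dvm.
    have [a ea] := frobA g@_m; exists (- a *: 'X_[m]).
    have -> : (g@_m *: 'X_[rt m]) ^+ p = g@_m ^+ p *: 'X_[m].
      rewrite exprZn mpolyXn; congr (_ *: 'X_[_]); apply/mnmP => i.
      by rewrite mulmnE mnmE divnK.
    rewrite -scalerBl ea opprD addrA subrr add0r.
    by rewrite -mulrN -scalerA scaler_nat mulr_natl.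
  - rewrite /h -!(big_filter _ dv).
    have [r ->] := sum_frob [seq m <- msupp g | dv m]
                            (fun m => g@_m *: 'X_[rt m]).
    by exists (- r); rewrite mulrN.
have [u eu] := gh.
have hpQ : h ^+ p \in Q.
  have -> : h ^+ p = g - p%:R * u by rewrite -eu; ring.
  by rewrite rpredB // mulrC idealMr.
have coefh m : h@_m != 0 -> exists k, [/\ g@_k != 0, dv k & m = rt k].
  move=> hm; apply: contrapT => nok; move/eqP: hm; apply.
  rewrite /h raddf_sum /= big_seq_cond big1 // => k /andP[].
  rewrite mcoeff_msupp mcoeffZ mcoeffX => gk dvk.
  have [ek|_] := eqVneq (rt k) m; last by rewrite mulr0.
  by case: nok; exists k.
have [||w ew] := IH h.
- split; first by apply: contraTT hpQ; apply: prime_notinX.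
  apply/vars_inP => m i /coefh[k [gk _ ->]]; rewrite mnmE => ki.
  by apply: (vars_inP _ _ gS) gk _; apply: contraNneq ki => ->; rewrite div0n.
- move=> m /coefh[k [/gn gk /forallP dvk ->]].
  have ek : mdeg k = (mdeg (rt k) * p)%N.
    rewrite !mdegE big_distrl; apply: eq_bigr => i _ /=.
    by rewrite mnmE divnK.
  by move: gk (prime_gt1 p_prime); rewrite ek; nia.
exists (u + p%:R ^+ p.-1 * w ^+ p).
have -> : g = g - h ^+ p + h ^+ p by rewrite subrK.
rewrite eu ew exprMn mulrDr mulrA -exprS prednK ?prime_gt0 //.
Qed.

End Dichotomy.

(** * Expansions along one generator *)

Section Expansion.
Variables (R : comNzRingType) (B : set R) (m : R).
Implicit Types (f g : R).

(** The truncated subtraction makes the condition on e j void for j >= n. *)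
Definition expansion n b f : Prop := exists2 e : nat -> R,
  forall j, ideal_exp B (n - j) (e j) & f = \sum_(j < b) m ^+ j * e j.

Lemma expansion0 n b : expansion n b 0.
Proof.
exists (fun=> 0) => [j|]; first exact: ideal_exp0.
by rewrite big1 // => j _; rewrite mulr0.
Qed.

Lemma expansion_add n b f g :
  expansion n b f -> expansion n b g -> expansion n b (f + g).
Proof.
move=> [e Ee ->] [h Eh ->]; exists (fun j => e j + h j).
  by move=> j; apply: ideal_exp_add.
by rewrite -big_split; apply: eq_bigr => j _; rewrite mulrDr.
Qed.

Lemma expansion_scale n b a f : expansion n b f -> expansion n b (a * f).
Proof.
move=> [e Ee ->]; exists (fun j => a * e j).
  by move=> j; apply: ideal_exp_scale.
by rewrite mulr_sumr; apply: eq_bigr => j _; rewrite mulrCA.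
Qed.

Lemma expansion_shift n b f : expansion n b f -> expansion n.+1 b.+1 (m * f).
Proof.
move=> [e Ee ->]; exists (fun j => if j is k.+1 then e k else 0).
  by case=> [|j]; [apply: ideal_exp0 | rewrite subSS].
rewrite big_ord_recl mulr0 add0r mulr_sumr; apply: eq_bigr => j _.
by rewrite mulrA -exprS.
Qed.

Lemma expansion_mul n x f :
  ideal_exp B 1 x -> expansion n n.+1 f -> expansion n.+1 n.+2 (x * f).
Proof.
move=> Ex [e Ee ->]; exists (fun j => if (j <= n)%N then x * e j else 0).
  move=> j; case: leqP => [jn|_]; last exact: ideal_exp0.
  rewrite subSn //; move: x Ex; apply: ideal_exp_ind => [|x y Ex Ey|x y Bx _].
  - by rewrite mul0r; apply: ideal_exp0.
  - by rewrite mulrDl; apply: ideal_exp_add.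
  - by rewrite -mulrA; apply: ideal_exp_mul => //; apply: ideal_exp_scale.
rewrite [RHS]big_ord_recr /= ltnn mulr0 addr0 mulr_sumr; apply: eq_bigr => j _.
by rewrite -ltnS ltn_ord mulrCA.
Qed.

(** A product of n elements of C, each of the form u m + e up to a multiplier,
is expanded in powers of m. *)
Lemma ideal_exp_expansion (Q : prime_idealr R) (C : set R) :
    (forall f, C f -> exists2 s, s \notin Q &
       exists u e, ideal_exp B 1 e /\ s * f = u * m + e) ->
  forall n f, ideal_exp C n f ->
    exists2 s, s \notin Q & expansion n n.+1 (s * f).
Proof.
move=> gen; elim=> [|n IH] f Ef.
  exists 1; first exact: loc_notin1.
  by exists (fun=> f) => [[]//|]; rewrite big_ord1 !mul1r.
move: f Ef; apply: ideal_exp_ind.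
- exists 1; first exact: loc_notin1.
  by rewrite mulr0; apply: expansion0.
- move=> f g [s sQ fs] [t tQ gt]; exists (s * t); first exact: loc_notinM.
  have -> : s * t * (f + g) = t * (s * f) + s * (t * g) by ring.
  by apply: expansion_add; apply: expansion_scale.
- move=> x f /gen[s sQ [u [e [Ee es]]]] /IH[t tQ ft].
  exists (s * t); first exact: loc_notinM.
  have -> : s * t * (x * f) = m * (u * (t * f)) + e * (t * f).
    by rewrite mulrACA es; ring.
  by apply: expansion_add; [apply/expansion_shift/expansion_scale
    | apply: expansion_mul].
Qed.

End Expansion.

(** * Mixed powers are contained in symbolic powers *)

Section Main.
Variables (p : nat) (p_prime : prime p) (A : comNzRingType) (d : nat).
Variables (p_regular : forall c : A, p%:R * c = 0 -> c = 0).
Variables (frobA : forall c : A, exists a, c ^+ p = c + p%:R * a).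
Local Notation R := {mpoly A[d]}.
Variables (delta : R -> R) (delta_p : is_p_derivation p delta).
Variables (Q : prime_idealr R) (pQ : p%:R \in Q).
Variables (constQ : forall c : A, c%:MP \in Q -> exists a, c = p%:R * a).
Implicit Types (f : R) (S : {set 'I_d}).
Local Notation B := (contraction Q).
Local Notation Sy := (symbolic_power Q).
Local Notation mix := (mixed_power A delta [set` Q]).

Lemma mpoly_p_regular f : p%:R * f = 0 -> f = 0.
Proof.
move=> pf; apply/mpolyP => m; rewrite mcoeff0; apply: p_regular.
by rewrite mulr_natl -mcoeffMn -mulr_natl pf mcoeff0.
Qed.

(** The factors of w that come from B_S commute with the Hasse derivative,
which reduces the claim to w of exponent 0, that is to [hasse_exp]. *)
Lemma hasse_lead S i b k m w : m \in Q -> i \notin S ->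
  ideal_exp (B S) k w ->
  ideal_exp [set` Q] k.+1 (hasse i b (m ^+ b * w) - hasse i 1 m ^+ b * w).
Proof.
move=> mQ iS; elim: k w => [|k IH] w Ew.
  rewrite -[X in ideal_exp _ _ X]mulr1; apply: ideal_exp_mul => //.
  exact: hasse_exp.
move: w Ew; apply: ideal_exp_ind.
- by rewrite !mulr0 hasse_zero subrr; apply: ideal_exp0.
- move=> x y Ex Ey; rewrite !mulrDr hasseD opprD addrACA.
  exact: ideal_exp_add.
- move=> x y Bx Ey; rewrite ![_ * (x * y)]mulrCA (hasse_free _ _ Bx.2 iS).
  by rewrite -mulrBr; apply: ideal_exp_mul; [case: Bx | apply: IH].
Qed.

Lemma sumr_rearrange (V : zmodType) (x y z w : V) :
  x + y + z - w = z + x + (y - w).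
Proof. by rewrite addrA [z + x]addrC [x + z + y]addrAC. Qed.

(** The induction on b removes the top term of an expansion of f: the Hasse
derivative of order b isolates e_b up to the factor (dm/dx_i)^b, which is
outside Q, and the hypothesis for S then applies to this derivative. *)
Lemma mixed_expansion S i m n b f :
    i \notin S -> m \in Q -> hasse i 1 m \notin Q ->
    (forall n f e v, mix n.+1 f -> ideal_exp (B S) n e -> Sy n.+1 v ->
      f = e + v -> Sy n.+1 f) ->
    (b <= n)%N -> mix n.+1 f ->
    (exists2 v, Sy n.+1 v & expansion (B S) m n b.+1 (f - v)) ->
  Sy n.+1 f.
Proof.
move=> iS mQ dmQ mainS; elim: b => [|b IHb] bn mf [v Sv [e Ee fe]].
  have Ee0 := Ee 0%N; rewrite subn0 in Ee0.
  apply: (mainS n f (e 0%N) v) => //.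
  by rewrite -[LHS](subrK v) fe big_ord1 mul1r.
move: fe; rewrite big_ord_recr /= => fe.
apply: (IHb (ltnW bn) mf); exists (v + m ^+ b.+1 * e b.+1); last first.
  by exists e => //; rewrite opprD addrA fe addrK.
apply: symbolic_power_add => //.
have nb : (n.+1 = b.+1 + (n - b.+1).+1)%N by lia.
rewrite nb; apply: symbolic_power_mulX => //.
apply: (symbolic_power_cancel (prime_notinX b.+1 dmQ)).
have dB := @hasse_diffop A d i b.+1.
have nb' : ((n.+1 - b.+1)%N = (n - b.+1).+1) by lia.
have mDf := mixed_power_diffop dB mf; rewrite nb' in mDf.
set w := _ * e b.+1.
pose v' := hasse i b.+1 f - w.
have Sv' : Sy (n - b.+1).+1 v'.
  have -> : v' = hasse i b.+1 v +
      \sum_(j < b.+1) hasse i b.+1 (m ^+ j * e j) +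
      (hasse i b.+1 (m ^+ b.+1 * e b.+1) - w).
    rewrite /v' -[in LHS](subrK v f) fe !hasseD.
    rewrite (big_morph _ (@hasseD _ _ i b.+1) (hasse_zero _ i b.+1)).
    exact: sumr_rearrange.
  apply: symbolic_power_add; last first.
    exact: symbolic_power_exp (hasse_lead b.+1 mQ iS (Ee b.+1)).
  apply: symbolic_power_add.
    by rewrite -nb'; apply: (diffop_symbolic dB Sv).
  elim/big_ind: _ => [||j _].
  - by apply/symbolic_power_exp/ideal_exp0.
  - by move=> x y; apply: symbolic_power_add.
  (* For j < b + 1 the order n - j of e_j is already at least n - b, and the
     factor e_j comes out of the derivative. *)
  apply: (@symbolic_power_le _ _ _ (n - j)%N); first by have := ltn_ord j; lia.
  apply/symbolic_power_exp/(ideal_exp_sub (@contraction_sub _ _ Q S)).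
  exact: hasse_ideal_exp.
have SDf : Sy (n - b.+1).+1 (hasse i b.+1 f).
  apply: (mainS _ _ w v' mDf) => //; first exact: ideal_exp_scale.
  by rewrite /v' addrC subrK.
have -> : w = hasse i b.+1 f - v' by rewrite /v' subKr.
exact: symbolic_power_sub.
Qed.

(** Induction on the size of S: a variable with a separable relation is
eliminated, and if there is none then f is p^n u modulo Q^(n+1) and delta^n
decides. The multiplier s is harmless, since mixed powers are stable under
multiplication by s and s can be cancelled in symbolic powers. *)
Lemma mixed_contraction S n f e v : mix n.+1 f ->
  ideal_exp (B S) n e -> Sy n.+1 v -> f = e + v -> Sy n.+1 f.
Proof.
have [N] := ubnP #|S|; elim: N S n f e v => // N IH S n f e v SN mf Ee Sv fev.
have [allQ|] := pselect (forall i g, i \in S -> B S g -> hasse i 1 g \in Q).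
  have Bp := contraction_pdiv p_prime frobA constQ pQ allQ.
  have [u eu] : exists u, e = p%:R ^+ n * u.
    elim: n e Ee {mf Sv fev} => [e _|k IHk e]; first by exists e; rewrite mul1r.
    elim/ideal_exp_ind => [|x y [u ->] [w ->]|x y /Bp[r ->] /IHk[w ->]].
    - by exists 0; rewrite mulr0.
    - by exists (u + w); rewrite mulrDr.
    - by exists (r * w); rewrite exprS; ring.
  have uQ : u \in Q.
    apply: (iter_p_derivation_detect p_prime mpoly_p_regular delta_p pQ Sv).
    by rewrite -eu -fev; apply: mixed_power_iter mf.
  rewrite fev eu; apply: symbolic_power_add => //.
  rewrite -addn1; apply: symbolic_power_mulX => //; exact/symbolic_power1.
move=> nall; have [i [g [iS Bg dg]]] :
    exists i g, [/\ i \in S, B S g & hasse i 1 g \notin Q].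
  apply: contrapT => noig; apply: nall => i g iS Bg.
  apply: contrapT => /negP dg.
  by apply: noig; exists i, g.
have [m [mQ dmQ gen]] := separable_generator Bg dg.
have [s sQ es] := ideal_exp_expansion gen Ee.
apply: (symbolic_power_cancel sQ).
have iS' : i \notin S :\ i by rewrite !inE eqxx.
have SN' : (#|S :\ i| < N)%N by move: SN; rewrite (cardsD1 i S) iS.
have msf := mixed_power_scale s mf.
apply: (mixed_expansion (b := n) iS' mQ dmQ _ (leqnn n) msf).
  move=> k g' e' v' mg Ee' Sv' eg; exact: (IH _ k g' e' v' SN').
exists (s * v); first exact: symbolic_power_scale.
by rewrite -mulrBr fev addrK.
Qed.

Lemma mixed_sub_symbolic n : mix n.+1 `<=` Sy n.+1.
Proof.
elim: n => [|n IH] f mf.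
  by apply/symbolic_power1; apply: (mixed_power_iter mf).
have /IH/symbolic_powerP[s sQ Es] := mixed_power_le (leqnSn n.+1) mf.
apply: (symbolic_power_cancel sQ).
apply: (@mixed_contraction finset.setT n.+1 _ (s * f) 0); last by rewrite addr0.
- exact: mixed_power_scale.
- by apply: ideal_exp_sub Es => x xQ; split=> //; apply: vars_inT.
- by apply/symbolic_power_exp/ideal_exp0.
Qed.

End Main.

(** * Residues modulo p of the coefficients *)

Section PadicArithmetic.
Variables (p : nat) (p_prime : prime p).
Local Notation Zp := (padic_int p).

Lemma padic_modE n : (Zp_trunc (p ^ n.+1)).+2 = (p ^ n.+1)%N.
Proof. by rewrite Zp_cast // -[1%N](expn0 p) ltn_exp2l ?prime_gt1. Qed.

Lemma padic_comp_nat n k : padic_comp (k%:R : Zp) n = k%:R.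
Proof. by elim: k => // k IH; rewrite -natr1 -[in RHS]natr1 -IH. Qed.

Lemma padic_comp_lt (x : Zp) n : (padic_comp x n < p ^ n.+1)%N.
Proof. by apply: leq_trans (ltn_ord _) _; rewrite padic_modE. Qed.

Lemma val_padic_red n (x : 'Z_(p ^ n.+2)) :
  padic_red x = (x %% p ^ n.+1)%N :> nat.
Proof. by rewrite /=; congr (_ %% _)%N; apply: padic_modE. Qed.

Lemma padic_comp_mod (x : Zp) n :
  padic_comp x n = (padic_comp x n.+1 %% p ^ n.+1)%N :> nat.
Proof. by rewrite -(padic_compat x n) val_padic_red. Qed.

Lemma val_natM n k (a : 'Z_(p ^ n.+1)) :
  (k%:R * a)%R = (k * a %% p ^ n.+1)%N :> nat.
Proof.
by rewrite mulr_natl Zp_mulrn /= mulnC; congr (_ %% _)%N; apply: padic_modE.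
Qed.

Lemma padic_val_p n (a : 'Z_(p ^ n.+2)) :
  p%:R * a = (p * (a %% p ^ n.+1))%N :> nat.
Proof. by rewrite muln_modr -expnS; apply: val_natM. Qed.

Lemma padic_p_regular (x : Zp) : p%:R * x = 0 -> x = 0.
Proof.
move=> px; apply: padic_int_ext => n; apply: ord_inj.
have /(congr1 (@nat_of_ord _)) : padic_comp (p%:R * x) n.+1 = 0 by rewrite px.
rewrite [padic_comp _ _](_ : _ = p%:R * padic_comp x n.+1); last first.
  by rewrite -padic_comp_nat.
rewrite [LHS]padic_val_p => /eqP.
rewrite muln_eq0 eqn0Ngt prime_gt0 //= => /eqP.
by rewrite -padic_comp_mod.
Qed.

(** The components of the quotient are those of x divided by p, shifted by one
index because dividing by p loses one power of p in the modulus. *)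
Lemma padic_divp (x : Zp) : padic_comp x 0 = 0 -> exists y, x = p%:R * y.
Proof.
move=> x0.
have dvp n : (p %| padic_comp x n)%N.
  elim: n => [|n IH]; first by rewrite x0.
  move: IH; rewrite padic_comp_mod /dvdn modn_dvdm // expnS; exact: dvdn_mulr.
have ltdiv n : (padic_comp x n.+1 %/ p < p ^ n.+1)%N.
  by rewrite ltn_divLR ?prime_gt0 // mulnC -expnS padic_comp_lt.
pose y n : 'Z_(p ^ n.+1) := inZp (padic_comp x n.+1 %/ p).
have valy n : y n = (padic_comp x n.+1 %/ p)%N :> nat.
  by rewrite /= (padic_modE n) modn_small.
have ycompat n : padic_red (y n.+1) = y n.
  apply: ord_inj; rewrite val_padic_red !valy.
  have : (padic_comp x n.+2 %/ p * p %% (p ^ n.+1 * p) = padic_comp x n.+1)%N.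
    by rewrite divnK // -expnSr -padic_comp_mod.
  by rewrite -muln_modl => <-; rewrite mulnK ?prime_gt0.
exists (PadicInt ycompat); apply: padic_int_ext => n; apply: ord_inj.
rewrite [padic_comp (_ * _) _](_ : _ = p%:R * y n); last first.
  by rewrite -padic_comp_nat.
rewrite [RHS]val_natM valy mulnC divnK // padic_comp_mod //.
Qed.

Lemma padic_residue (x : Zp) : exists k y, x = k%:R + p%:R * y.
Proof.
pose k := (padic_comp x 0 : nat).
have [|y ey] := @padic_divp (x - k%:R).
  rewrite [padic_comp _ _](_ : _ = padic_comp x 0 - k%:R); last first.
    by rewrite -padic_comp_nat.
  by rewrite natr_Zp subrr.
by exists k, y; rewrite -ey addrC subrK.
Qed.

End PadicArithmetic.

Lemma natr_frob (A : comNzRingType) p k : prime p ->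
  exists a : A, (k%:R : A) ^+ p = k%:R + p%:R * a.
Proof.
move=> p_pr; elim: k => [|k [a ea]].
  by exists 0; rewrite mulr0 addr0 expr0n eqn0Ngt prime_gt0.
have [r er] := exprDn_prime (k%:R : A) 1 p_pr; exists (a + k%:R * r).
by rewrite -natr1 er ea expr1n; ring.
Qed.

Lemma frob_residue (A : comNzRingType) p : prime p ->
    (forall c : A, exists k b, c = k%:R + p%:R * b) ->
  forall c : A, exists a, c ^+ p = c + p%:R * a.
Proof.
move=> p_pr res c; have [k [b ->]] := res c.
have [r ->] := exprDn_prime (k%:R : A) (p%:R * b) p_pr.
have [a ->] := natr_frob A k p_pr.
exists (a + p%:R ^+ p.-1 * b ^+ p + k%:R * (p%:R * b) * r - b).
have -> : (p%:R * b) ^+ p = p%:R * (p%:R ^+ p.-1 * b ^+ p).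
  by rewrite exprMn mulrA -exprS prednK ?prime_gt0.
ring.
Qed.

Lemma int_residue p : prime p ->
  forall c : int, exists k b, c = k%:R + p%:R * b.
Proof.
move=> p_pr c; exists `|(c %% p)%Z|%N, (c %/ p)%Z.
have p0 : (p : int) != 0 by rewrite eqz_nat -lt0n prime_gt0.
rewrite !natz gez0_abs ?modz_ge0 // addrC mulrC.
exact: divz_eq.
Qed.

Theorem theorem2 (p : nat) (p_prime : prime p) (A : comNzRingType)
    (hA : A = (int : comNzRingType) \/ A = (padic_int p : comNzRingType))
    (d : nat) (delta : {mpoly A[d]} -> {mpoly A[d]})
    (hdelta : is_p_derivation p delta)
    (Q : prime_idealr {mpoly A[d]})
    (hQ : (@mpolyC d A) @^-1` [set` Q] = ideal_span [set p%:R]) (n : nat)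
    (hn : (1 <= n)%N) :
  symbolic_power Q n = mixed_power A delta [set` Q] n.
Proof.
have p_regular (c : A) : p%:R * c = 0 -> c = 0.
  case: hA => eA; move: c; rewrite eA => c; last exact: padic_p_regular.
  by move/eqP; rewrite mulf_eq0 natz eqz_nat eqn0Ngt prime_gt0 //= => /eqP.
have residue (c : A) : exists k b, c = k%:R + p%:R * b.
  case: hA => eA; move: c; rewrite eA => c; first exact: int_residue.
  exact: padic_residue.
have pQ : p%:R \in Q.
  have : ideal_span [set p%:R] (p%:R : A).
    by rewrite -[X in _ X]mul1r; apply: ideal_span_mul.
  by rewrite -hQ /= rmorph_nat.
have constQ (c : A) : c%:MP \in Q -> exists a, c = p%:R * a.
  move=> cQ; have : ideal_span [set p%:R] c by rewrite -hQ.
  elim/ideal_span_ind => [|x y [a ->] [b ->]|a x ->].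
  - by exists 0; rewrite mulr0.
  - by exists (a + b); rewrite mulrDr.
  - by exists a; rewrite mulrC.
have frobA := frob_residue p_prime residue.
case: n hn => // n _; apply/seteqP; split.
  have mpoly_reg := mpoly_p_regular (d := d) p_regular.
  exact: (symbolic_sub_mixed p_prime mpoly_reg hdelta pQ).
exact: (mixed_sub_symbolic p_prime p_regular frobA hdelta pQ constQ).
Qed.
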